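(* Let $p$ be a prime, $l$ a positive integer, and let $E/F$ be a cyclic Galois extension of degree $q=p^l$ with Galois group $G=\mathrm{Gal}(E/F)$. Assume $F$ contains a primitive $p$-th root of unity. Let $B$ be a subgroup of $E^{\times}$ containing $E^{\times p}=\{a^p : a\in E^\times\}$ and invariant under the action of $G$, and suppose that $B/E^{\times p}$ is a finitely generated $\mathbb{F}_p[G]$-module. Let $E_B=E(B^{1/p})$ and $N_B=\mathrm{Gal}(E_B/E)$. Then $B/E^{\times p}$ and $N_B$ are isomorphic as $\mathbb{F}_p[G]$-modules.
   Context: $E_B=E(B^{1/p})$ denotes the field obtained by adjoining to $E$ all $p$-th roots of elements of $B$; it is Galois over $E$ with $N_B$ abelian of exponent $p$, and since $B$ is $G$-invariant, $E_B$ is Galois over $F$. The $\mathbb{F}_p[G]$-module structure on $B/E^{\times p}$ is induced by the Galois action: $g([b])=[g(b)]$ (group written multiplicatively, so scalars in $\mathbb{F}_p$ act by exponentiation). The $\mathbb{F}_p[G]$-module structure on $N_B$ (written additively) is given by conjugation: for $g\in G$ and $\tau\in N_B$, $g\cdot\tau=\tilde g\tau\tilde g^{-1}$, where $\tilde g\in\mathrm{Gal}(E_B/F)$ is any lift of $g$; this is independent of the choice of lift since $N_B$ is abelian. *)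

(* Defs.v *)
From HB Require Import structures.
From mathcomp Require Import all_boot all_order all_algebra all_fingroup.
From mathcomp Require Import all_solvable all_field.
From mathcomp Require Import generic_quotient boolp.

Set Implicit Arguments.
Unset Strict Implicit.
Unset Printing Implicit Defensive.

Import GRing.Theory.
Local Open Scope group_scope.
Local Open Scope ring_scope.
Local Open Scope quotient_scope.

(* A K[G]-module is a K-module with a linear action of G.  As everywhere in
   MathComp actions are on the right: gmod_act x (a * b) is
   gmod_act (gmod_act x a) b.  For Galois groups this is the usual left action
   by function application, because (a * b) x = b (a x) there. *)
Record gmodule (K : pzRingType) (gT : finGroupType) (G : {group gT}) := GModule {
  gmod_sort :> lmodType K;
  gmod_act : action G gmod_sort;
  gmod_act_linear : {in G, forall a, linear (gmod_act^~ a)}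
}.

Definition gmodule_fg (K : pzRingType) (gT : finGroupType) (G : {group gT})
    (M : gmodule K G) : Prop :=
  exists s : seq M, forall x : M, exists c : 'I_(size s) -> gT -> K,
    x = \sum_(i < size s) \sum_(a in G) c i a *: gmod_act M s`_i a.

Definition gmodule_isog (K : pzRingType) (gT : finGroupType) (G : {group gT})
    (M N : gmodule K G) : Prop :=
  exists2 f : {linear M -> N}, bijective f &
    {in G, forall a x, f (gmod_act M x a) = gmod_act N (f x) a}.

Section FpSpace.

Variables (p : nat) (V : zmodType).

Definition fp_space (p_pr : prime p) (pV : forall x : V, x *+ p = 0) : Type := V.

Variables (p_pr : prime p) (pV : forall x : V, x *+ p = 0).

HB.instance Definition _ := GRing.Zmodule.on (fp_space p_pr pV).

(* In multiplicative notation, scalars act by exponentiation. *)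
Definition fp_scale (c : 'F_p) (x : fp_space p_pr pV) : fp_space p_pr pV :=
  (x : V) *+ (c : nat).

Lemma fp_mulrn_mod (x : V) n : x *+ (n %% p) = x *+ n.
Proof.
by rewrite [in RHS](divn_eq n p) mulrnDr mulnC mulrnA pV mul0rn add0r.
Qed.

Lemma fp_scaleA c d x : fp_scale c (fp_scale d x) = fp_scale (c * d) x.
Proof.
rewrite /fp_scale /= -mulrnA mulnC -[LHS]fp_mulrn_mod.
by congr (_ *+ (_ %% _)); rewrite Fp_cast.
Qed.

Lemma fp_scale1 : left_id 1 fp_scale.
Proof. by []. Qed.

Lemma fp_scaleDr : right_distributive fp_scale +%R.
Proof. by move=> c x y; rewrite /fp_scale mulrnDl. Qed.

Lemma fp_scaleDl x : {morph fp_scale^~ x : c d / c + d}.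
Proof.
move=> c d; rewrite /fp_scale /= -mulrnDr -[RHS]fp_mulrn_mod.
by congr (_ *+ (_ %% _)); rewrite Fp_cast.
Qed.

HB.instance Definition _ := GRing.Zmodule_isLmodule.Build 'F_p (fp_space p_pr pV)
  fp_scaleA fp_scale1 fp_scaleDr fp_scaleDl.

Lemma fp_additive_linear (f : V -> V) :
  {morph f : x y / x + y} -> linear (f : fp_space p_pr pV -> fp_space p_pr pV).
Proof.
move=> fD c x y; rewrite fD; congr (_ + _).
have f0 : f 0 = 0 by apply: (addrI (f 0)); rewrite -fD !addr0.
rewrite /GRing.scale /= /fp_scale; elim: (c : nat) => [|n IH].
  by rewrite !mulr0n.
by rewrite !mulrS fD IH.
Qed.

End FpSpace.

Record kummer_group (p : nat) (F : fieldType) (E : splittingFieldType F) :=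
  KummerGroup {
    kg_mem :> {pred E};
    kg_nz : 0 \notin kg_mem;
    kg_divr : divr_closed kg_mem;
    kg_pow : forall a : E, a != 0 -> a ^+ p \in kg_mem;
    kg_gal : forall g, g \in 'Gal({:E} / 1) ->
               forall b, b \in kg_mem -> g b \in kg_mem
  }.

Section KummerQuotient.

Variables (p : nat) (F : fieldType) (E : splittingFieldType F).
Variable B : kummer_group p E.

Definition kg_elt := {b : E | b \in kg_mem B}.
HB.instance Definition _ := SubChoice.on kg_elt.

Definition elt b (Bb : b \in kg_mem B) : kg_elt := exist _ b Bb.

Lemma kg_eltP (x : kg_elt) : val x \in kg_mem B. Proof. exact: (valP x). Qed.

Lemma kg_neq0 b : b \in kg_mem B -> b != 0.
Proof. by move=> Bb; apply: contraNneq (kg_nz B) => <-. Qed.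

Lemma kg_1 : 1 \in kg_mem B. Proof. by case: (kg_divr B). Qed.

Lemma kg_inv b : b \in kg_mem B -> b^-1 \in kg_mem B.
Proof. by have [B1 Bdiv] := kg_divr B => Bb; rewrite -div1r Bdiv. Qed.

Lemma kg_mul b c : b \in kg_mem B -> c \in kg_mem B -> b * c \in kg_mem B.
Proof.
by have [_ Bdiv] := kg_divr B => Bb Bc; rewrite -(invrK c) Bdiv ?kg_inv.
Qed.

Lemma gal_full_in (g : gal_of {:E}) : g \in 'Gal({:E} / 1).
Proof. by rewrite gal_kHom ?sub1v // k1AHom. Qed.

Definition elt1 : kg_elt := elt kg_1.
Definition eltM (x y : kg_elt) : kg_elt := elt (kg_mul (kg_eltP x) (kg_eltP y)).
Definition eltV (x : kg_elt) : kg_elt := elt (kg_inv (kg_eltP x)).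
Definition eltJ (g : gal_of {:E}) (x : kg_elt) : kg_elt :=
  elt (kg_gal (gal_full_in g) (kg_eltP x)).

Definition pth_equiv (x y : kg_elt) : bool :=
  `[< exists2 a : E, a != 0 & val x = val y * a ^+ p >].

Lemma pth_equivP x y :
  reflect (exists2 a : E, a != 0 & val x = val y * a ^+ p) (pth_equiv x y).
Proof. exact: asboolP. Qed.

Lemma pth_equiv_equiv : equiv_class_of pth_equiv.
Proof.
split.
- by move=> x; apply/pth_equivP; exists 1; rewrite ?oner_neq0 ?expr1n ?mulr1.
- have sym x y : pth_equiv x y -> pth_equiv y x.
    move=> /pth_equivP[a nza xE]; apply/pth_equivP; exists a^-1.
      by rewrite invr_eq0.
    by rewrite xE exprVn mulfK // expf_neq0.
  by move=> x y; apply/idP/idP; apply: sym.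
- move=> y x z /pth_equivP[a nza xE] /pth_equivP[c nzc yE].
  apply/pth_equivP; exists (c * a); first by rewrite mulf_neq0.
  by rewrite xE yE exprMn mulrA.
Qed.

Canonical pth_equiv_rel := EquivRelPack pth_equiv_equiv.

Definition kummer_quot := {eq_quot pth_equiv_rel}.
HB.instance Definition _ := Choice.on kummer_quot.

Definition kq_class (x : kg_elt) : kummer_quot := \pi_({eq_quot pth_equiv_rel}) x.
Definition kq_repr (u : kummer_quot) : kg_elt :=
  repr (u : {eq_quot pth_equiv_rel}).

Lemma kq_reprK u : kq_class (kq_repr u) = u. Proof. exact: reprK. Qed.

Lemma kq_classP x y :
  reflect (exists2 a : E, a != 0 & val x = val y * a ^+ p)
          (kq_class x == kq_class y).
Proof. by rewrite /kq_class eqmodE; apply: pth_equivP. Qed.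

Definition kq_zero : kummer_quot := kq_class elt1.
Definition kq_add (u v : kummer_quot) := kq_class (eltM (kq_repr u) (kq_repr v)).
Definition kq_opp (u : kummer_quot) := kq_class (eltV (kq_repr u)).
Definition kq_act (u : kummer_quot) (g : gal_of {:E}) :=
  kq_class (eltJ g (kq_repr u)).

Lemma kq_repr_class x :
  exists2 a : E, a != 0 & val (kq_repr (kq_class x)) = val x * a ^+ p.
Proof. by apply/kq_classP; rewrite kq_reprK. Qed.

Lemma kq_addE x y : kq_add (kq_class x) (kq_class y) = kq_class (eltM x y).
Proof.
have [a nza aE] := kq_repr_class x; have [c nzc cE] := kq_repr_class y.
apply/eqP/kq_classP; exists (a * c); first by rewrite mulf_neq0.
by rewrite /= aE cE exprMn mulrACA.
Qed.

Lemma kq_oppE x : kq_opp (kq_class x) = kq_class (eltV x).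
Proof.
have [a nza aE] := kq_repr_class x.
apply/eqP/kq_classP; exists a^-1; first by rewrite invr_eq0.
by rewrite /= aE invfM exprVn.
Qed.

Lemma kq_actE x g : kq_act (kq_class x) g = kq_class (eltJ g x).
Proof.
have [a nza aE] := kq_repr_class x.
apply/eqP/kq_classP; exists (g a); first by rewrite fmorph_eq0.
by rewrite /= aE rmorphM rmorphXn.
Qed.

Lemma kq_addA : associative kq_add.
Proof.
move=> u v w; rewrite -(kq_reprK u) -(kq_reprK v) -(kq_reprK w) !kq_addE.
by congr kq_class; apply: val_inj; rewrite /= mulrA.
Qed.

Lemma kq_addC : commutative kq_add.
Proof.
move=> u v; rewrite -(kq_reprK u) -(kq_reprK v) !kq_addE.
by congr kq_class; apply: val_inj; rewrite /= mulrC.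
Qed.

Lemma kq_add0 : left_id kq_zero kq_add.
Proof.
move=> u; rewrite -(kq_reprK u) kq_addE.
by congr kq_class; apply: val_inj; rewrite /= mul1r.
Qed.

Lemma kq_addN : left_inverse kq_zero kq_opp kq_add.
Proof.
move=> u; rewrite -(kq_reprK u) kq_oppE kq_addE.
by congr kq_class; apply: val_inj; rewrite /= mulVf ?kg_neq0 // kg_eltP.
Qed.

HB.instance Definition _ :=
  GRing.isZmodule.Build kummer_quot kq_addA kq_addC kq_add0 kq_addN.

Lemma kq_mulrn x n (Bxn : val x ^+ n \in kg_mem B) :
  kq_class x *+ n = kq_class (elt Bxn).
Proof.
elim: n Bxn => [|n IH] Bxn.
  by rewrite mulr0n; congr kq_class; apply: val_inj.
have Bn : val x ^+ n \in kg_mem B.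
  by elim: (n) => [|m IHm]; rewrite ?kg_1 // exprS kg_mul // kg_eltP.
rewrite mulrS (IH Bn) [LHS]kq_addE.
by congr kq_class; apply: val_inj; rewrite /= exprS.
Qed.

Lemma kq_expp (u : kummer_quot) : u *+ p = 0.
Proof.
rewrite -(kq_reprK u); set x := kq_repr u.
have nzx : val x != 0 by rewrite kg_neq0 // kg_eltP.
rewrite (kq_mulrn (kg_pow B nzx)).
by apply/eqP/kq_classP; exists (val x); rewrite //= mul1r.
Qed.

Lemma kq_act_add g : {morph kq_act^~ g : u v / u + v}.
Proof.
move=> u v; rewrite -(kq_reprK u) -(kq_reprK v) [_ + _]kq_addE !kq_actE.
rewrite [RHS]kq_addE.
by congr kq_class; apply: val_inj; rewrite /= rmorphM.
Qed.

Lemma kq_act_is_action : is_action 'Gal({:E} / 1) kq_act.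
Proof.
have actM u a b : kq_act u (a * b)%g = kq_act (kq_act u a) b.
  rewrite -(kq_reprK u) !kq_actE; congr kq_class.
  by apply: val_inj; rewrite /= galM ?memvf.
have act1 u : kq_act u 1%g = u.
  rewrite -[in LHS](kq_reprK u) !kq_actE -[RHS]kq_reprK; congr kq_class.
  by apply: val_inj; rewrite /= gal_id.
split=> [g u v eq_uv|u a b _ _]; last exact: actM.
by rewrite -[u]act1 -[v]act1 -(mulgV g) !actM eq_uv.
Qed.

Definition kummer_module (p_pr : prime p) : gmodule 'F_p 'Gal({:E} / 1) :=
  @GModule 'F_p _ 'Gal({:E} / 1)%G (fp_space p_pr kq_expp)
    (Action kq_act_is_action)
    (fun g _ => @fp_additive_linear _ _ p_pr kq_expp _ (kq_act_add g)).

End KummerQuotient.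

Section AddGroup.

Variables (gT : finGroupType) (N : {group gT}).

Definition add_group (abN : abelian N) : Type := subg_of N.

Variable abN : abelian N.

HB.instance Definition _ := Finite.on (add_group abN).

Definition ag_add (x y : add_group abN) : add_group abN :=
  ((x : subg_of N) * (y : subg_of N))%g.
Definition ag_opp (x : add_group abN) : add_group abN := ((x : subg_of N)^-1)%g.
Definition ag_zero : add_group abN := (1 : subg_of N)%g.

Lemma ag_addA : associative ag_add. Proof. exact: mulgA. Qed.
Lemma ag_addC : commutative ag_add.
Proof.
by move=> x y; apply: val_inj; apply: (centsP abN); apply: subgP.
Qed.
Lemma ag_add0 : left_id ag_zero ag_add. Proof. exact: mul1g. Qed.
Lemma ag_addN : left_inverse ag_zero ag_opp ag_add. Proof. exact: mulVg. Qed.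

HB.instance Definition _ :=
  GRing.isZmodule.Build (add_group abN) ag_addA ag_addC ag_add0 ag_addN.

Lemma ag_mulrn (x : add_group abN) n :
  sgval (x *+ n : add_group abN) = (sgval x ^+ n)%g.
Proof. by elim: n => [|n IH] //; rewrite mulrS expgS -IH. Qed.

End AddGroup.

(* The field E(B^{1/p}): over the image of E every 'X^p - b with b in B splits,
   and the p-th roots of the elements of B generate.  This determines ke_field
   up to isomorphism over E.  Taking it in splittingFieldType F makes it a
   finite normal extension of F; that such an extension exists is not assumed
   here and has to be derived from the finiteness of B / E^{*p}. *)
Record kummer_ext (p : nat) (F : fieldType) (E : splittingFieldType F)
    (B : kummer_group p E) := KummerExt {
  ke_field :> splittingFieldType F;
  ke_in : 'AHom(E, ke_field);
  ke_split : forall b, b \in kg_mem B ->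
    exists rs : seq ke_field,
      'X^p - (ke_in b)%:P = \prod_(r <- rs) ('X - r%:P);
  ke_gen : forall K : {subfield ke_field}, (limg ke_in <= K)%VS ->
    (forall y b, b \in kg_mem B -> y ^+ p = ke_in b -> y \in K) ->
    K = {:ke_field}%VS :> {vspace ke_field}
}.

Section KummerGal.

Variables (p : nat) (F : fieldType) (E : splittingFieldType F).
Variables (p_pr : prime p) (muF : exists z : F, p.-primitive_root z).
Variables (B : kummer_group p E) (EB : kummer_ext B).

Local Notation iota := (ke_in EB).

Definition kummer_gal : {group gal_of {:EB}} := 'Gal({:EB} / limg iota)%G.
Local Notation NB := kummer_gal.

Lemma kummer_galP (t : gal_of {:EB}) :
  reflect (forall x, t (iota x) = iota x) (t \in NB).
Proof.
apply: (iffP idP) => [tN x | tfix].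
  by apply: (fixed_gal _ tN); rewrite ?subvf ?memv_img ?memvf.
rewrite gal_kHom ?subvf //; apply/kAHomP => _ /memv_imgP[x _ ->].
exact: tfix.
Qed.

Lemma kummer_gal_root (t : gal_of {:EB}) b (y : EB) :
    t \in NB -> b \in kg_mem B -> y ^+ p = iota b ->
  exists z : F, z ^+ p = 1 /\ t y = z *: y.
Proof.
move=> tN Bb yE; have [z0 pz0] := muF.
have nzy : y != 0.
  apply: contraTneq (kg_neq0 Bb) => y0; rewrite negbK -(fmorph_eq0 iota).
  by apply/eqP; rewrite -[LHS]yE y0 expr0n eqn0Ngt prime_gt0.
have pz : p.-primitive_root (GRing.in_alg EB z0) by rewrite fmorph_primitive_root.
have : (t y / y) ^+ p = 1.
  rewrite expr_div_n -rmorphXn yE /= (kummer_galP _ tN) divff //.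
  by rewrite fmorph_eq0 (kg_neq0 Bb).
case/(prim_rootP pz) => i Ei; exists (z0 ^+ i); split.
  by rewrite exprAC (prim_expr_order pz0) expr1n.
rewrite -(divfK nzy (t y)) Ei -mulr_algl; congr (_ * _).
exact: esym (rmorphXn (GRing.in_alg EB) i z0).
Qed.

Lemma kummer_gal_eq1 (t : gal_of {:EB}) : t \in NB ->
    (forall y b, b \in kg_mem B -> y ^+ p = iota b -> t y = y) ->
  t = 1%g.
Proof.
move=> tN troot.
have full : fixedField [set t] = {:EB}%VS :> {vspace EB}.
  apply: (@ke_gen _ _ _ _ EB (fixedField_aspace [set t])).
    apply/subvP => _ /memv_imgP[x _ ->]; apply/fixedFieldP; rewrite ?memvf //.
    by move=> _ /set1P->; apply/kummer_galP.
  move=> y b Bb yE; apply/fixedFieldP; rewrite ?memvf // => _ /set1P->.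
  exact: troot yE.
apply/eqP/gal_eqP => x _; rewrite gal_id.
have : x \in fixedField [set t] by rewrite full memvf.
by case/mem_fixedFieldP => _; apply; rewrite set11.
Qed.

Lemma kummer_gal_eq (s t : gal_of {:EB}) : s \in NB -> t \in NB ->
    (forall y b, b \in kg_mem B -> y ^+ p = iota b -> s y = t y) ->
  s = t.
Proof.
move=> sN tN st; apply/(mulIg t^-1%g); rewrite mulgV.
apply: kummer_gal_eq1 => [|y b Bb yE]; first by rewrite groupM ?groupV.
by rewrite galM ?memvf // (st y b) // -galM ?memvf // mulgV gal_id.
Qed.

Lemma kummer_gal_abelian : abelian NB.
Proof.
apply/centsP => s sN t tN.
apply: kummer_gal_eq => [||y b Bb yE]; rewrite ?groupM //.
have [c [_ Es]] := kummer_gal_root sN Bb yE.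
have [d [_ Et]] := kummer_gal_root tN Bb yE.
by rewrite !galM ?memvf // Es Et !linearZ /= Es Et !scalerA mulrC.
Qed.

Lemma kummer_gal_expp (t : gal_of {:EB}) : t \in NB -> (t ^+ p)%g = 1%g.
Proof.
move=> tN; apply: kummer_gal_eq => [||y b Bb yE]; rewrite ?groupX ?group1 //.
have [c [cp Et]] := kummer_gal_root tN Bb yE; rewrite gal_id.
have tnE n : (t ^+ n)%g y = c ^+ n *: y.
  elim: n => [|n IH]; first by rewrite gal_id expr0 scale1r.
  by rewrite expgSr galM ?memvf // IH linearZ /= Et scalerA -exprSr.
by rewrite tnE cp scale1r.
Qed.

Lemma kummer_gal_mulrn (x : add_group kummer_gal_abelian) : x *+ p = 0.
Proof.
by apply: val_inj; rewrite /= ag_mulrn kummer_gal_expp // subgP.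
Qed.

Definition is_lift (g : gal_of {:E}) (h : gal_of {:EB}) : bool :=
  (h \o iota == iota \o g)%VF.

Lemma is_liftP (g : gal_of {:E}) (h : gal_of {:EB}) :
  reflect (forall x, h (iota x) = iota (g x)) (is_lift g h).
Proof.
apply: (iffP eqP) => [/lfunP gh x | gh].
  by have := gh x; rewrite !comp_lfunE.
by apply/lfunP => x; rewrite !comp_lfunE gh.
Qed.

Lemma lift_exists (g : gal_of {:E}) : exists h, is_lift g h.
Proof.
have ker0 : lker iota == 0%VS by apply/lker0P; apply: fmorph_inj.
pose f : 'End(EB) := (iota \o g \o iota^-1)%VF.
have fE x : f (iota x) = iota (g x) by rewrite !comp_lfunE lker0_lfunK.
have hom_f : kHom 1 (limg iota) f.
  rewrite k1HomE; apply/ahom_inP; split.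
    move=> u v /memv_imgP[x _ ->] /memv_imgP[y _ ->].
    by rewrite -rmorphM !fE !rmorphM.
  by rewrite -(rmorph1 iota) fE !rmorph1.
have ext : (1 <= iota @: {:E} <= {:EB})%VS by rewrite sub1v subvf.
have [h _ hE] := kHom_to_gal ext (normalFieldf 1) hom_f.
by exists h; apply/is_liftP => x; rewrite -hE ?fE // memv_img ?memvf.
Qed.

Definition gal_lift (g : gal_of {:E}) : gal_of {:EB} := xchoose (lift_exists g).

Lemma gal_liftP g x : gal_lift g (iota x) = iota (g x).
Proof. by apply: is_liftP; apply: xchooseP. Qed.

Lemma kummer_gal_conj g h (t : gal_of {:EB}) :
  is_lift g h -> t \in NB -> (t ^ h)%g \in NB.
Proof.
move=> /is_liftP gh tN; apply/kummer_galP => x.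
rewrite conjgE !galM ?memvf //.
have -> : (h^-1)%g (iota x) = iota ((g^-1)%g x).
  have -> : iota x = h (iota ((g^-1)%g x)).
    by rewrite gh -(galM (g^-1)%g g) ?memvf // mulVg gal_id.
  by rewrite -galM ?memvf // mulgV gal_id.
rewrite (kummer_galP _ tN) gh.
by rewrite -(galM (g^-1)%g g) ?memvf // mulVg gal_id.
Qed.

(* Multiplication in gal_of is composition in the reverse order, so that the
   automorphism h \o t \o h^-1 is the element h^-1 * t * h = t ^ h. *)
Definition kgal_act (t : add_group kummer_gal_abelian) (g : gal_of {:E}) :
    add_group kummer_gal_abelian :=
  Subg (kummer_gal_conj (introT (is_liftP _ _) (gal_liftP g)) (subgP t)).

Lemma kgal_actE (t : add_group kummer_gal_abelian) g h :
  is_lift g h -> sgval (kgal_act t g) = (sgval t ^ h)%g.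
Proof.
move=> /is_liftP gh /=; set h0 := gal_lift g.
have hN : (h0 * h^-1)%g \in NB.
  apply/kummer_galP => x; rewrite galM ?memvf // gal_liftP -gh.
  by rewrite -galM ?memvf // mulgV gal_id.
rewrite -[in LHS](mulgKV h h0) conjgM; congr (_ ^ h)%g.
rewrite conjgE (centsP kummer_gal_abelian _ (subgP t) _ hN).
by rewrite mulKg.
Qed.

Lemma kgal_actP (t : add_group kummer_gal_abelian) g h x : is_lift g h ->
  sgval (kgal_act t g) (h x) = h (sgval t x).
Proof.
move=> gh; rewrite (kgal_actE t gh) conjgE !galM ?memvf //.
by rewrite -[(h^-1)%g (h x)]galM ?memvf // mulgV gal_id.
Qed.

Lemma kgal_act_add g : {morph kgal_act^~ g : s t / s + t}.
Proof. by move=> s t; apply: val_inj; rewrite /= conjMg. Qed.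

Lemma kgal_act_is_action : is_action 'Gal({:E} / 1) kgal_act.
Proof.
split=> [g s t /(congr1 val) /= /conjg_inj eq_st | t a b _ _].
  exact: val_inj.
have ab : is_lift (a * b)%g (gal_lift a * gal_lift b)%g.
  by apply/is_liftP => x; rewrite !galM ?memvf // !gal_liftP.
by apply: val_inj; rewrite [LHS](kgal_actE t ab) /= conjgM.
Qed.

Definition kummer_gal_module : gmodule 'F_p 'Gal({:E} / 1) :=
  @GModule 'F_p _ 'Gal({:E} / 1)%G (fp_space p_pr kummer_gal_mulrn)
    (Action kgal_act_is_action)
    (fun g _ => @fp_additive_linear _ _ p_pr kummer_gal_mulrn _ (kgal_act_add g)).

End KummerGal.

(* Main.v *)
(* Write M = B/E^{*p} and N = N_B.  As F contains the p-th roots of unity, which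
   G fixes, the Kummer pairing (t, b) |-> t(b^{1/p}) / b^{1/p} is a perfect
   G-invariant pairing N x M -> F_p, so that N is the contragredient of M.  A
   generator of the cyclic p-group G acts on M by a unipotent matrix A, and every
   unipotent A preserves a nondegenerate bilinear form: split off a Jordan block
   of maximal size and induct.  Hence M is isomorphic to its contragredient.
   E_B is obtained as a splitting field over E of the product of the X^p - g(b_i)
   for g in G and b_i running over representatives of generators of M; this
   product has coefficients in F, so that E_B is normal over F. *)

Require Import Defs.
From HB Require Import structures.
From mathcomp Require Import all_boot all_order all_algebra all_fingroup.
From mathcomp Require Import all_solvable all_field.
From mathcomp Require Import boolp zify.

Set Implicit Arguments.
Unset Strict Implicit.
Unset Printing Implicit Defensive.

Import GRing.Theory.
Local Open Scope group_scope.
Local Open Scope ring_scope.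

(** * Invariant bilinear forms of unipotent matrices *)

Section UnipotentForm.

Variable K : fieldType.

(** Reversing the order of the rows makes [S] lower triangular, with the antidiagonal of [S] as its
    diagonal; the determinant is then a product of nonzero entries. *)
Lemma antitriangular_unitmx n (S : 'M[K]_n) :
    (forall i j : 'I_n, (n <= i + j)%N -> S i j = 0) ->
    (forall i j : 'I_n, (i + j).+1 = n -> S i j != 0) ->
  S \in unitmx.
Proof.
move=> S0 S1.
have uR : row_perm (perm rev_ord_inj) S \in unitmx.
  rewrite unitmxE det_trig.
    rewrite unitfE; apply/prodf_neq0 => i _; rewrite mxE permE; apply: S1 => /=.
    by have := ltn_ord i; lia.
  apply/is_trig_mxP => i j ltij; rewrite mxE permE S0 //=.
  by have := ltn_ord i; lia.
by move: uR; rewrite row_permE unitmx_mul unitmx_perm.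
Qed.

(* The block spanned by the rows of V is a Jordan block J of A of maximal
   size, and the columns of H span one of the contragredient A^-T. *)
Lemma unipotent_cyclic_block n m (A : 'M[K]_n) :
    A \in unitmx -> (0 < n)%N -> (A - 1) ^+ m = 0 ->
  exists k (V : 'M[K]_(k.+1, n)) (H : 'M[K]_(n, k.+1)) (J : 'M[K]_k.+1),
    [/\ V *m A = J *m V, invmx A *m H = H *m J^T & V *m H \in unitmx].
Proof.
move=> uA n_gt0 Am.
have n1 : (1 : 'M[K]_n) != 0.
  apply/eqP => /matrixP/(_ (Ordinal n_gt0) (Ordinal n_gt0)).
  by rewrite !mxE eqxx => /eqP; rewrite oner_eq0.
have exk : exists k, (A - 1) ^+ k == 0 by exists m; apply/eqP.
(* The least exponent, written [k.+1], is the nilpotency index of [A - 1], hence the maximal size of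
   a Jordan block. *)
case: (ex_minnP exk) => -[|k]; first by rewrite expr0 (negbTE n1).
set N := A - 1 => /eqP Nk1 mink.
have Nk : N ^+ k != 0 by apply/negP => /mink; rewrite ltnn.
set B := invmx A; pose N' := B - 1.
have AB : A * B = 1 by rewrite -mulmxE mulmxV.
have BA : B * A = 1 by rewrite -mulmxE mulVmx.
have N'E : N' = - B * N by rewrite /N mulNr mulrBr BA mulr1 opprB.
have cBN : GRing.comm (- B) N.
  rewrite /GRing.comm /N mulNr mulrN mulrBr mulrBl AB BA.
  by rewrite mulr1 mul1r.
have N'X j : N' ^+ j = (- B) ^+ j * N ^+ j by rewrite N'E exprMn_comm.
have NN' i j : N ^+ i * N' ^+ j = (- B) ^+ j * N ^+ (i + j).
  rewrite N'X mulrA exprD mulrA; congr (_ * _).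
  by apply/commr_sym/commrX/commr_sym/commrX.
have N_ge i : (k < i)%N -> N ^+ i = 0.
  by move=> ki; rewrite -(subnKC ki) exprD Nk1 mul0r.
(* Since [N ^+ k.+1 = 0], [B] acts as the identity on [N ^+ k]:
   [(B - 1) * N ^+ k = - B * N ^+ k.+1 = 0]. *)
have BNk j : (- B) ^+ j * N ^+ k = (-1) ^+ j * N ^+ k.
  elim: j => [|j IH]; first by rewrite !expr0.
  have : - B * N ^+ k = -1 * N ^+ k.
    apply/eqP; rewrite -subr_eq0 -mulrBl opprK addrC -opprB -/N' N'E.
    by rewrite mulNr -mulrA -exprS Nk1 mulr0 oppr0.
  by rewrite exprSr -mulrA => ->; rewrite mulN1r mulrN IH exprS mulN1r mulNr.
(* A nonzero entry of [N ^+ k] selects the cyclic vectors: row [i] of [V] is row [i0] of [N ^+ i],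
   and column [j] of [H] is column [j0] of [N' ^+ j]. [J] has ones on the diagonal and just above
   it. *)
have /matrix0Pn[i0 [j0 nz]] := Nk.
exists k, (\matrix_(i < k.+1, j < n) (N ^+ i) i0 j).
exists (\matrix_(i < n, j < k.+1) (N' ^+ j) i j0).
exists (\matrix_(i, j) ((i == j :> nat) + (i.+1 == j :> nat))%:R).
(* The last row of [J] has no superdiagonal entry; the condition [F k.+1 = 0] accounts for it. *)
have sumJ (F : nat -> K) (i : 'I_k.+1) : F k.+1 = 0 ->
    \sum_(j < k.+1) ((i == j :> nat) + (i.+1 == j :> nat))%:R * F j
      = F i + F i.+1.
  move=> F0; under eq_bigr do rewrite natrD mulrDl.
  rewrite big_split /=; congr (_ + _).
    rewrite (bigD1 i) //= eqxx mul1r big1 ?addr0 // => j neji.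
    by rewrite [_ == _](negbTE _) ?mul0r // eq_sym.
  have := ltn_ord i; rewrite ltnS leq_eqVlt => /predU1P[->|ltik].
    by rewrite F0 big1 // => j _; rewrite gtn_eqF ?mul0r.
  rewrite (bigD1 (@Ordinal k.+1 i.+1 ltik)) //= eqxx mul1r.
  rewrite big1 ?addr0 // => j neji.
  by rewrite [_ == _](negbTE _) ?mul0r // eq_sym.
have NA i : N ^+ i *m A = N ^+ i + N ^+ i.+1.
  by rewrite exprSr mulmxE /N mulrBr mulr1 addrCA subrr addr0.
have BN' i : B *m N' ^+ i = N' ^+ i + N' ^+ i.+1.
  by rewrite exprS mulmxE {2}/N' mulrBl mul1r addrCA subrr addr0.
split.
- apply/matrixP => i j; rewrite !mxE.
  under eq_bigr do rewrite mxE.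
  under [RHS]eq_bigr do rewrite !mxE.
  rewrite (sumJ (fun a => (N ^+ a) i0 j)) ?Nk1 ?mxE //.
  by have /matrixP/(_ i0 j) := NA i; rewrite !mxE.
- apply/matrixP => i j; rewrite !mxE.
  under eq_bigr do rewrite mxE.
  under [RHS]eq_bigr do rewrite !mxE mulrC.
  rewrite (sumJ (fun a => (N' ^+ a) i j0)); last first.
    by rewrite N'X Nk1 mulr0 mxE.
  by have /matrixP/(_ i j0) := BN' j; rewrite !mxE.
have VH (i j : 'I_k.+1) :
  ((\matrix_(i < k.+1, j < n) (N ^+ i) i0 j) *m
   (\matrix_(i < n, j < k.+1) (N' ^+ j) i j0)) i j = (N ^+ i * N' ^+ j) i0 j0.
  by rewrite -mulmxE !mxE; apply: eq_bigr => a _; rewrite !mxE.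
(* The entry is that of [(- B) ^+ j * N ^+ (i + j)] at [i0], [j0]: zero for [i + j > k], and the
   chosen nonzero entry up to sign for [i + j = k]. *)
apply: antitriangular_unitmx => i j ij; rewrite VH NN'.
  by rewrite N_ge // mulr0 mxE.
case: ij => ->; rewrite BNk.
have [->|->] : (-1) ^+ j = 1 :> 'M[K]_n \/ (-1) ^+ j = -1 :> 'M[K]_n.
- by rewrite -signr_odd; case: odd; rewrite ?expr0 ?expr1; auto.
- by rewrite mul1r.
- by rewrite mulN1r mxE oppr_eq0.
Qed.

(* S is the matrix of a nondegenerate bilinear form preserved by A. *)
Lemma unipotent_form n m (A : 'M[K]_n) :
    A \in unitmx -> (A - 1) ^+ m = 0 ->
  exists2 S : 'M[K]_n, S \in unitmx & A *m S *m A^T = S.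
Proof.
elim/ltn_ind: n => n IH in A *; move=> uA Am.
have [n0|n_gt0] := posnP n.
  by subst n; exists 1; rewrite ?unitmx1 //; apply/matrixP => -[].
have [k [V [H [J [VA BH uS1]]]]] := unipotent_cyclic_block uA n_gt0 Am.
set S1 := V *m H in uS1 *; set B := invmx A in BH.
(* [J] passes through [V] as [A] and [J^T] passes through [H] as the inverse of [A], and the two
   cancel. *)
have JS1 : J *m S1 *m J^T = S1.
  by rewrite /S1 mulmxA -VA -!mulmxA -BH mulKVmx.
have uJ : J \in unitmx.
  move: uS1; rewrite -JS1 !unitmx_mul; by case/andP => /andP[].
(* The complement of the block is the left kernel of [H]; it is proper because [V *m H] is
   invertible, so the induction applies to it. *)
have [s [W [ltsn freeW subW WH]]] : exists s (W : 'M[K]_(s, n)),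
    [/\ (s < n)%N, row_free W,
        forall r (u : 'M_(r, n)), u *m H = 0 -> (u <= W)%MS & W *m H = 0].
  exists (\rank (kermx H)), (row_base (kermx H)); split.
  - rewrite mxrank_ker -subn_gt0 subKn ?rank_leq_row // lt0n mxrank_eq0.
    by apply: contraTneq uS1 => H0; rewrite /S1 H0 mulmx0 unitmxE det0 unitr0.
  - exact: row_base_free.
  - by move=> r u uH; rewrite eq_row_base; apply/sub_kermxP.
  - by apply/sub_kermxP; rewrite eq_row_base.
(* Q1 and Q2 give the coordinates along the rows of V and of W. *)
pose Q1 := H *m invmx S1.
pose Q2 := (1%:M - Q1 *m V) *m pinvmx W.
have WQ1 : W *m Q1 = 0 by rewrite mulmxA WH mul0mx.
have VQ1 : V *m Q1 = 1%:M by rewrite mulmxA mulmxV.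
have PW : Q2 *m W = 1%:M - Q1 *m V.
  apply/mulmxKpV/subW.
  by rewrite mulmxBl mul1mx -mulmxA -/S1 /Q1 -mulmxA mulVmx // mulmx1 subrr.
have QQ : Q1 *m V + Q2 *m W = 1%:M by rewrite PW addrC subrK.
have WQ2 : W *m Q2 = 1%:M.
  apply: (row_free_inj freeW); rewrite -mulmxA PW mulmxBr mulmxA WQ1.
  by rewrite mul0mx subr0 mulmx1 mul1mx.
have VQ2 : V *m Q2 = 0.
  apply: (row_free_inj freeW); rewrite -mulmxA PW mulmxBr mulmxA VQ1.
  by rewrite mul0mx mul1mx mulmx1 subrr.
(* The kernel is stable under [A]: [W *m A *m H *m J^T = W *m H = 0], and [J^T] is invertible. *)
have [A2 WA] : exists A2, W *m A = A2 *m W.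
  apply/submxP/subW.
  have HA : A *m H *m J^T = H.
    by rewrite -mulmxA -BH mulKVmx.
  have uJT : J^T \in unitmx by rewrite unitmx_tr.
  apply: (can_inj (mulmxK uJT)).
  transitivity (W *m (A *m H *m J^T)); first by rewrite !mulmxA.
  by rewrite HA WH mul0mx.
have uA2 : A2 \in unitmx.
  rewrite -row_free_unit /row_free eqn_leq rank_leq_row /=.
  rewrite -{1}(eqP freeW) -(mxrankMfree W (_ : row_free A)) ?row_free_unit //.
  by rewrite WA mxrankM_maxl.
have A2m : (A2 - 1) ^+ m = 0.
  have WN j : W *m (A - 1) ^+ j = (A2 - 1) ^+ j *m W.
    elim: j => [|j IHj]; first by rewrite !expr0 mulmx1 mul1mx.
    rewrite !exprSr -!mulmxE mulmxA IHj -!mulmxA; congr (_ *m _).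
    by rewrite mulmxBl mulmxBr WA mulmx1 mul1mx.
  by apply: (row_free_inj freeW); rewrite -WN Am mulmx0 mul0mx.
have [S2 uS2 AS2] := IH _ ltsn A2 uA2 A2m.
have AQ1 : A *m Q1 = Q1 *m J.
  rewrite -[LHS]mul1mx -QQ mulmxDl -!mulmxA (mulmxA V) VA (mulmxA W) WA.
  by rewrite -!mulmxA VQ1 WQ1 !mulmx0 addr0 mulmx1.
have AQ2 : A *m Q2 = Q2 *m A2.
  rewrite -[LHS]mul1mx -QQ mulmxDl -!mulmxA (mulmxA V) VA (mulmxA W) WA.
  by rewrite -!mulmxA VQ2 WQ2 !mulmx0 add0r mulmx1.
(* Orthogonal sum of [S1] on the rows of [V] and [S2] on the rows of [W]. For nondegeneracy,
   multiplying by [V^T] or by [W^T] isolates one summand. *)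
exists (Q1 *m S1 *m Q1^T + Q2 *m S2 *m Q2^T).
  rewrite -row_free_unit -kermx_eq0; apply/eqP/row_matrixP => i.
  rewrite row0; set u := row i _.
  have uS : u *m (Q1 *m S1 *m Q1^T + Q2 *m S2 *m Q2^T) = 0.
    by rewrite /u -row_mul mulmx_ker row0.
  have u1 : u *m Q1 = 0.
    apply: (can_inj (mulmxK uS1)); rewrite mul0mx.
    transitivity (u *m (Q1 *m S1 *m Q1^T + Q2 *m S2 *m Q2^T) *m V^T).
      rewrite mulmxDr mulmxDl -!mulmxA -!trmx_mul VQ1 VQ2 trmx1 trmx0.
      by rewrite !mulmx0 addr0 mulmx1.
    by rewrite uS mul0mx.
  have u2 : u *m Q2 = 0.
    apply: (can_inj (mulmxK uS2)); rewrite mul0mx.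
    transitivity (u *m (Q1 *m S1 *m Q1^T + Q2 *m S2 *m Q2^T) *m W^T).
      rewrite mulmxDr mulmxDl -!mulmxA -!trmx_mul WQ1 WQ2 trmx1 trmx0.
      by rewrite !mulmx0 add0r mulmx1.
    by rewrite uS mul0mx.
  by rewrite -(mulmx1 u) -QQ mulmxDr (mulmxA u) u1 (mulmxA u) u2 !mul0mx addr0.
(* A form preserved by [M] pulls back, along coordinates intertwining [A] with [M], to a form
   preserved by [A]. *)
have push r (Q : 'M_(n, r)) (T M : 'M_r) : A *m Q = Q *m M ->
    M *m T *m M^T = T -> A *m (Q *m T *m Q^T) *m A^T = Q *m T *m Q^T.
  move=> AQ MT; rewrite (mulmxA A) (mulmxA A) AQ -(mulmxA _ Q^T) -trmx_mul AQ.
  by rewrite trmx_mul -{2}MT !mulmxA.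
by rewrite mulmxDr mulmxDl (push _ _ _ _ AQ1 JS1) (push _ _ _ _ AQ2 AS2).
Qed.

End UnipotentForm.
(** * Modules over cyclic p-groups with a perfect invariant pairing *)

Section GmoduleAction.

Variables (K : pzRingType) (gT : finGroupType) (G : {group gT}) (M : gmodule K G).

Lemma gmod_act_inj a : injective (gmod_act M ^~ a).
Proof. by case: (gmod_act M) => f actf; have [inj _] := actf; exact: inj. Qed.

Lemma gmod_actM x : {in G &, forall a b,
  gmod_act M x (a * b)%g = gmod_act M (gmod_act M x a) b}.
Proof. by case: (gmod_act M) => f actf; have [_ morph] := actf; exact: morph. Qed.

(** The axioms of an action give injectivity and multiplicativity only; cancelling one action of the
    unit gives the rest. *)
Lemma gmod_act1 x : gmod_act M x 1%g = x.
Proof. by apply: (@gmod_act_inj 1%g); rewrite -gmod_actM ?mulg1. Qed.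

End GmoduleAction.

Section SelfDual.

Variable K : fieldType.

(** A spanning family of minimal size is free, since a nontrivial relation would allow one member to
    be dropped. *)
Lemma lmod_basis (M : lmodType K) r (e : 'I_r -> M) :
    (forall x, exists c : 'I_r -> K, x = \sum_i c i *: e i) ->
  exists n (b : 'I_n -> M),
    bijective (fun u : 'rV[K]_n => \sum_i u 0 i *: b i).
Proof.
pose spanning n := exists b : 'I_n -> M,
  forall x, exists c : 'I_n -> K, x = \sum_i c i *: b i.
move=> span_e; have ex_span : exists n, `[< spanning n >].
  by exists r; apply/asboolP; exists e.
case: (ex_minnP ex_span) => n /asboolP[b span_b] min_n.
have free_b (u : 'rV_n) : \sum_i u 0 i *: b i = 0 -> u = 0.
  case: n => [|n] in b span_b min_n u *; first by move=> _; apply/rowP => -[].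
  move=> u0; apply/rowP => k; rewrite mxE; apply/eqP; apply: contraT => nzk.
  suff /min_n : `[< spanning n >] by rewrite ltnn.
  apply/asboolP; exists (fun j => b (lift k j)) => x.
  have [c ->] := span_b x.
  (* Subtracting [c k / u 0 k] times the relation [u] kills the coefficient of index [k]. *)
  exists (fun j => c (lift k j) - c k / u 0 k * u 0 (lift k j)).
  transitivity (\sum_i (c i - c k / u 0 k * u 0 i) *: b i).
    under [RHS]eq_bigr do rewrite scalerBl -scalerA.
    by rewrite sumrB -scaler_sumr u0 scaler0 subr0.
  by rewrite (bigD1_ord k) //= divfK // subrr scale0r add0r.
exists n, b; set psi := fun u => _.
have inj_psi : injective psi.
  move=> u v uv; apply/eqP; rewrite -subr_eq0; apply/eqP/free_b.
  under eq_bigr do rewrite !mxE scalerBl.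
  by rewrite sumrB -/(psi u) uv subrr.
have surj_psi x : exists u, psi u == x.
  have [c ->] := span_b x; exists (\row_i c i); apply/eqP.
  by apply: eq_bigr => i _; rewrite mxE.
exists (fun x => xchoose (surj_psi x)) => [u|x].
  by apply: inj_psi; apply/eqP; apply: (xchooseP (surj_psi (psi u))).
by apply/eqP; apply: (xchooseP (surj_psi x)).
Qed.

Lemma linear_mulmx m n (f : 'rV[K]_m -> 'rV[K]_n) : linear f ->
  exists A, forall u, f u = u *m A.
Proof.
move=> lin_f.
pose fL : {linear 'rV[K]_m -> 'rV[K]_n} :=
  HB.pack f (GRing.isLinear.Build _ _ _ _ f lin_f).
by exists (lin1_mx fL) => u; rewrite mul_rV_lin1.
Qed.

(** The vector [c] is orthogonal to every row of [U] but not to [v], so [v] lies outside the row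
    space of [U]. *)
Lemma row_free_col_rV k n (U : 'M[K]_(k, n)) (v c : 'rV_n) :
  row_free U -> c *m U^T = 0 -> c *m v^T != 0 -> row_free (col_mx v U).
Proof.
move=> free_U cU nzv.
rewrite -kermx_eq0; apply/rowV0P => w /sub_kermxP.
rewrite -[w]hsubmxK mul_row_col => w0.
have w1 : lsubmx w = 0 :> 'M_1.
  have : (lsubmx w *m v + rsubmx w *m U) *m c^T = 0 by rewrite w0 mul0mx.
  have -> : lsubmx w *m v = (lsubmx w : 'M_1) 0 0 *: v.
    by rewrite [lsubmx w in LHS]mx11_scalar mul_scalar_mx.
  rewrite mulmxDl -scalemxAl -mulmxA -[U *m _]trmxK trmx_mul trmxK cU.
  rewrite trmx0 mulmx0 addr0 -[v *m _]trmxK trmx_mul trmxK => /eqP.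
  rewrite scaler_eq0 trmx_eq0 (negbTE nzv) orbF => /eqP w00.
  by rewrite [LHS]mx11_scalar w00 raddf0.
move: w0; rewrite w1 mul0mx add0r => w2.
rewrite (_ : rsubmx w = 0) ?row_mx0 //.
by apply: (row_free_inj free_U); rewrite w2 mul0mx.
Qed.

(** The image of [d] lies in no hyperplane. As long as fewer than [n] independent values are known,
    some nonzero [c] is orthogonal to all of them, and a value not orthogonal to [c] enlarges the
    family. *)
Lemma row_separating_surj (N : lmodType K) n (d : N -> 'rV[K]_n) : linear d ->
    (forall c : 'rV_n, (forall t, c *m (d t)^T = 0) -> c = 0) ->
  forall u, exists t, d t = u.
Proof.
move=> lin_d sep.
have free_im k : (k <= n)%N -> exists t : 'I_k -> N, row_free (\matrix_i d (t i)).
  elim: k => [|k IH] lekn.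
    by exists (fun i => 0); rewrite /row_free -leqn0 rank_leq_row.
  have [t free_t] := IH (ltnW lekn); set U := \matrix_i _ in free_t.
  have [c nzc cU] : exists2 c : 'rV_n, c != 0 & c *m U^T = 0.
    have : kermx U^T != 0.
      rewrite -mxrank_eq0 mxrank_ker mxrank_tr (eqP free_t) subn_eq0.
      by rewrite -ltnNge.
    case/rowV0Pn => c /sub_kermxP cU nzc; by exists c.
  have [s nzs] : exists s, c *m (d s)^T != 0.
    apply: contrapT => abs; case/eqP: nzc; apply: sep => s.
    by apply: contrapT => /eqP ?; apply: abs; exists s.
  exists (fun i : 'I_(1 + k) => if split i is inr j then t j else s).
  rewrite (_ : \matrix_i _ = col_mx (d s) U :> 'M_(1 + k, n)); last first.
    apply/row_matrixP => i; rewrite rowK -[i]splitK.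
    case: (split i) => j; rewrite unsplitK /= ?rowKu ?rowKd ?rowK //.
    by rewrite ord1 row_id.
  exact: (row_free_col_rV free_t cU nzs).
move=> u; have [t free_t] := free_im n (leqnn n).
have uT : \matrix_i d (t i) \in unitmx by rewrite -row_free_unit.
pose dL : {linear N -> 'rV[K]_n} :=
  HB.pack d (GRing.isLinear.Build _ _ _ _ d lin_d).
pose c := u *m invmx (\matrix_i d (t i)).
exists (\sum_i c 0 i *: t i).
rewrite -[LHS]/(dL _) linear_sum -[RHS](mulmxKV uT) -/c mulmx_sum_row.
by apply: eq_bigr => i _; rewrite linearZ rowK.
Qed.

(** In characteristic [p] the Frobenius map is additive on commuting matrices, so the power is
    [A ^+ (p ^ l) - 1]. *)
Lemma unipotent_pchar p l n (A : 'M[K]_n) :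
  p \in [pchar K] -> A ^+ (p ^ l) = 1 -> (A - 1) ^+ (p ^ l) = 0.
Proof.
case: n A => [|n] A charK A1; first by apply/matrixP => -[].
have charM : p \in [pchar 'M[K]_n.+1] by rewrite pchar_lalg.
have frob k : (A - 1) ^+ (p ^ k) = A ^+ (p ^ k) - 1.
  elim: k => [|k IH]; first by rewrite !expr1.
  rewrite expnSr !exprM IH -(pFrobenius_autE charM).
  by rewrite pFrobenius_autB_comm ?pFrobenius_autE ?expr1n //; apply: commr1.
by rewrite frob A1 subrr.
Qed.

(** In coordinates a generator acts on [M] by [A] and, through the pairing, on [N] by the inverse of
    [A^T]. A matrix [S] with [A *m S *m A^T = S] intertwines the two. *)
Lemma gmodule_isog_of_pairing p l (gT : finGroupType) (G : {group gT})
    (M N : gmodule K G) (b : M -> N -> K) :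
    p \in [pchar K] -> cyclic G -> #|G| = (p ^ l)%N -> gmodule_fg M ->
    (forall x, linear (b x : N -> K^o)) ->
    (forall t, linear (b^~ t : M -> K^o)) ->
    (forall x, (forall t, b x t = 0) -> x = 0) ->
    (forall t, (forall x, b x t = 0) -> t = 0) ->
    {in G, forall a x t, b (gmod_act M x a) (gmod_act N t a) = b x t} ->
  gmodule_isog M N.
Proof.
move=> charK /cyclicP[g defG] cardG [s span_s] linr linl ndl ndr inv_b.
have Gg : g \in G by rewrite defG cycle_id.
have [n [e [phi psiK phiK]]] : exists n (e : 'I_n -> M),
    bijective (fun u : 'rV[K]_n => \sum_i u 0 i *: e i).
  (* Over [K], the translates of the generators span. The index runs over all of [gT], and elements
     outside [G] get coefficient 0. *)
  apply: (@lmod_basis M #|{: 'I_(size s) * gT}|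
    (fun k => let ia := enum_val k in gmod_act M s`_(ia.1) ia.2)) => x.
  have [c ->] := span_s x.
  exists (fun k => let ia := enum_val k in (ia.2 \in G)%:R * c ia.1 ia.2) => /=.
  rewrite pair_big_dep /= big_mkcond /=.
  rewrite (reindex (@enum_val _ {: 'I_(size s) * gT})) /=.
    apply: eq_bigr => k _; case: ifP => _; first by rewrite mul1r.
    by rewrite mul0r scale0r.
  exact/onW_bij/enum_val_bij.
set psi := (fun u => _) in psiK phiK.
have lin_psi : linear psi.
  move=> c u v; rewrite /psi scaler_sumr -big_split.
  by apply: eq_bigr => i _; rewrite !mxE scalerDl scalerA.
pose psiL : {linear 'rV[K]_n -> M} :=
  HB.pack psi (GRing.isLinear.Build _ _ _ _ psi lin_psi).
have lin_phi : linear phi := can2_linear (psiK : cancel psiL phi) phiK.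
have [A actA] : exists A, forall u, phi (gmod_act M (psi u) g) = u *m A.
  apply: linear_mulmx => c u v.
  by rewrite lin_psi (gmod_act_linear Gg) lin_phi.
have psiA u : psi (u *m A) = gmod_act M (psi u) g by rewrite -actA phiK.
have psi0 : psi 0 = 0 := raddf0 psiL.
have uA : A \in unitmx.
  rewrite -row_free_unit -kermx_eq0; apply/rowV0P => u /sub_kermxP uA0.
  have act0 : gmod_act M 0 g = 0.
    pose gL : {linear M -> M} := HB.pack (gmod_act M ^~ g)
      (GRing.isLinear.Build _ _ _ _ (gmod_act M ^~ g) (gmod_act_linear Gg)).
    exact: (raddf0 gL).
  have : gmod_act M (psi u) g = gmod_act M 0 g.
    by rewrite -psiA uA0 psi0 act0.
  by move/(@gmod_act_inj _ _ _ M g); rewrite -psi0 => /(can_inj psiK).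
have psiAX k u : psi (u *m A ^+ k) = gmod_act M (psi u) (g ^+ k)%g.
  elim: k => [|k IH] in u *; first by rewrite expr0 mulmx1 gmod_act1.
  by rewrite exprSr -mulmxE mulmxA psiA IH expgSr gmod_actM ?groupX.
have A1 : (A - 1) ^+ (p ^ l) = 0.
  apply: unipotent_pchar charK _; rewrite -cardG; apply/row_matrixP => i.
  rewrite !rowE mulmx1.
  by apply: (can_inj psiK); rewrite psiAX expg_cardG // gmod_act1.
have [S uS AS] := unipotent_form uA A1.
pose d t : 'rV[K]_n := \row_i b (e i) t.
have lin_d : linear d.
  by move=> c t t'; apply/rowP => i; rewrite !mxE linr.
have bE u t : b (psi u) t = (u *m (d t)^T) 0 0.
  pose bL : {linear M -> K^o} :=
    HB.pack (b^~ t) (GRing.isLinear.Build _ _ _ _ (b^~ t) (linl t)).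
  rewrite -[LHS]/(bL _) linear_sum mxE.
  by apply: eq_bigr => i _; rewrite linearZ !mxE.
have inj_d t : d t = 0 -> t = 0.
  by move=> dt0; apply: ndr => x; rewrite -[x]phiK bE dt0 trmx0 mulmx0 mxE.
(* Nondegeneracy in [N] made [d] injective; nondegeneracy in [M] makes it surjective. *)
have surj_d u : exists t, d t == u.
  suff [t <-] : exists t, d t = u by exists t.
  apply: row_separating_surj => // c c0; apply: (can_inj psiK); rewrite psi0.
  by apply: ndl => t; rewrite bE c0 mxE.
pose dinv u := xchoose (surj_d u).
have dinvK : cancel dinv d by move=> u; apply/eqP/(xchooseP (surj_d u)).
have dK : cancel d dinv.
  move=> t; apply/eqP; rewrite -subr_eq0; apply/eqP/inj_d.
  by rewrite -scaleN1r addrC lin_d dinvK scaleN1r addNr.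
have lin_dinv : linear dinv.
  by move=> c u v; apply: (can_inj dK); rewrite lin_d !dinvK.
(* Invariance of the pairing, evaluated on the basis vectors. *)
have actN t : d (gmod_act N t g) *m A^T = d t.
  apply: trmx_inj; rewrite trmx_mul trmxK; apply/row_matrixP => i.
  rewrite !rowE mulmxA; apply/matrixP => i0 j0; rewrite !ord1 -!bE psiA.
  exact: inv_b.
pose f x := dinv (phi x *m S).
have lin_f : linear f by move=> c x y; rewrite /f lin_phi mulmxDl -scalemxAl lin_dinv.
pose fL : {linear M -> N} := HB.pack f (GRing.isLinear.Build _ _ _ _ f lin_f).
exists fL.
  exists (fun t => psi (d t *m invmx S)) => [x|t].
    by rewrite /= /f dinvK mulmxK.
  by rewrite /= /f psiK mulmxKV.
have fg x : f (gmod_act M x g) = gmod_act N (f x) g.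
  have uAT : A^T \in unitmx by rewrite unitmx_tr.
  apply: (can_inj dK); apply: (can_inj (mulmxK uAT)).
  by rewrite actN /f !dinvK -{1}[x]phiK actA -!mulmxA (mulmxA A) AS.
move=> a Ga x /=; have /cycleP[k ->] : a \in <[g]>%g by rewrite -defG.
elim: k => [|k IH]; first by rewrite !gmod_act1.
by rewrite expgSr !gmod_actM ?groupX // fg IH.
Qed.

End SelfDual.
(** * The Kummer pairing *)

Section KummerPairing.

(** The roots are the [z ^+ i * y]. Their distinctness is the separability used to find a second
    conjugate in [kummer_gal_fixed_root]. *)
Lemma Xn_sub_exp_prod (L : fieldType) p (z y : L) :
    (0 < p)%N -> p.-primitive_root z -> y != 0 ->
  exists2 rs : seq L, uniq rs &
    'X^p - (y ^+ p)%:P = \prod_(r <- rs) ('X - r%:P).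
Proof.
move=> p_gt0 pz nzy; pose rs := [seq z ^+ i * y | i <- index_iota 0 p].
have uniq_rs : uniq rs.
  rewrite map_inj_in_uniq ?iota_uniq // => i j.
  rewrite !mem_index_iota /= => ltip ltjp /(mulIf nzy)/eqP.
  by rewrite (eq_prim_root_expr pz) !modn_small // => /eqP.
exists rs => //.
have sz : size ('X^p - (y ^+ p)%:P) = p.+1.
  by rewrite size_XnsubC.
have mon : lead_coef ('X^p - (y ^+ p)%:P) = 1 by apply/eqP/monicXnsubC.
have := @all_roots_prod_XsubC _ ('X^p - (y ^+ p)%:P) rs.
rewrite mon scale1r uniq_rootsE; apply=> //.
  by rewrite sz size_map size_iota subn0.
apply/allP => _ /mapP[i _ ->]; rewrite rootE !hornerE exprMn exprAC.
by rewrite (prim_expr_order pz) expr1n mul1r subrr.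
Qed.

Lemma fp_additive_scalar p (V : zmodType) (p_pr : prime p)
    (pV : forall x : V, x *+ p = 0) (f : fp_space p_pr pV -> 'F_p) :
  {morph f : x y / x + y} -> linear (f : fp_space p_pr pV -> ('F_p)^o).
Proof.
move=> fD c x y; rewrite fD; congr (_ + _).
have f0 : f 0 = 0 by apply: (addrI (f 0)); rewrite -fD !addr0.
have fMn n : f (x *+ n) = f x *+ n.
  by elim: n => [|n IH]; rewrite ?mulr0n ?mulrS ?fD ?IH.
by rewrite [f _]fMn -[LHS]mulr_natl natr_Zp.
Qed.

Variables (p : nat) (F : fieldType) (E : splittingFieldType F).
Variables (p_pr : prime p) (muF : exists z : F, p.-primitive_root z).
Variables (B : kummer_group p E) (EB : kummer_ext B).

Local Notation iota := (ke_in EB).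
Local Notation M := (kummer_module B p_pr).
Local Notation N := (kummer_gal_module p_pr muF EB).

Lemma kummer_root b : b \in kg_mem B ->
  exists2 y : EB, y != 0 & y ^+ p = iota b.
Proof.
move=> Bb; have [rs rsE] := @ke_split _ _ _ _ EB b Bb.
have p_gt0 := prime_gt0 p_pr.
have : (0 < size rs)%N.
  by rewrite -ltnS -(size_prod_XsubC rs id) -rsE size_XnsubC.
case: rs rsE => // y rs rsE _.
have yE : y ^+ p = iota b.
  apply/eqP; rewrite -subr_eq0; move: (root_prod_XsubC (y :: rs) y).
  by rewrite -rsE mem_head rootE !hornerE.
exists y => //; apply: contraTneq (kg_neq0 Bb) => y0.
by rewrite negbK -(fmorph_eq0 iota) -[X in X == _]yE y0 expr0n eqn0Ngt p_gt0.
Qed.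

(** If [y] were not in the image of [E], its minimal polynomial, a divisor of the separable
    ['X^p - y ^+ p], would have another root [y'], and by normality some element of the Galois group
    would send [y] to [y']. *)
Lemma kummer_gal_fixed_root b (y : EB) : b \in kg_mem B -> y ^+ p = iota b ->
  (forall t, t \in kummer_gal EB -> t y = y) -> exists a, y = iota a.
Proof.
move=> Bb yE fix_y; pose K := (iota @: {:E})%AS.
suff /memv_imgP[a _ ->] : y \in K by exists a.
apply: contrapT => /negP y'K; have [z0 pz0] := muF.
have nzy : y != 0 by apply: contraNneq y'K => ->; apply: mem0v.
have pz : p.-primitive_root (GRing.in_alg EB z0) by rewrite fmorph_primitive_root.
have [rs uniq_rs rsE] := Xn_sub_exp_prod (prime_gt0 p_pr) pz nzy.
have /dvdp_prod_XsubC[m minE] : minPoly K y %| \prod_(r <- rs) ('X - r%:P).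
  rewrite -rsE minPoly_dvdp ?rootE ?hornerE ?subrr //.
  rewrite rpredB ?rpredX ?polyOverX ?polyOverC // yE.
  by rewrite memv_img ?memvf.
have [y' nyy' ry'] : exists2 y', y' != y & root (minPoly K y) y'.
  have szm : (1 < size (mask m rs))%N.
    have : size (minPoly K y) = (size (mask m rs)).+1.
      by rewrite (eqp_size minE) size_prod_XsubC.
    rewrite size_minPoly => -[<-].
    by rewrite ltn_neqAle eq_sym adjoin_deg_eq1 y'K.
  have um : uniq (mask m rs) by apply: mask_uniq.
  case: (mask m rs) minE szm um => [|r [|r' s]] // minE _ /= /andP[rr' _].
  have rr : root (minPoly K y) r /\ root (minPoly K y) r'.
    by rewrite !(eqp_root minE) !root_prod_XsubC !inE !eqxx orbT.
  have [ry|] := eqVneq r y; last by exists r; case: rr.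
  exists r'; last by case: rr.
  by apply: contraNneq rr' => ->; rewrite ry mem_head.
pose f := kHomExtend K \1 y y'.
have [hom1K lf1p] := (kHom1 K K, lfun1_poly).
have homKy : kHom K <<K; y>> f by apply/kHomExtendP; rewrite ?lf1p.
have ext : (K <= <<K; y>> <= {:EB})%VS by rewrite subv_adjoin subvf.
have [t tN tE] := kHom_to_gal ext (normalFieldf K) homKy.
have : t y = y'.
  by rewrite -tE ?memv_adjoin // (kHomExtend_val hom1K) ?lf1p.
by rewrite fix_y // => yy'; rewrite yy' eqxx in nyy'.
Qed.

Variables (z0 : F) (pz0 : p.-primitive_root z0).

(** The choice of [z0] identifies the additive group of ['F_p] with the [p]-th roots of unity, so
    that the Kummer pairing takes values in ['F_p]. *)
Lemma Fp_exprD (c d : 'F_p) : z0 ^+ (c + d)%R = z0 ^+ c * z0 ^+ d.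
Proof.
rewrite -exprD -(prim_expr_mod pz0 (c + d)%N) /=.
by congr (_ ^+ (_ %% _)); rewrite Fp_cast.
Qed.

Lemma Fp_expr_inj : injective (fun c : 'F_p => z0 ^+ c).
Proof.
have ltp (c : 'F_p) : (c < p)%N by rewrite -[X in (_ < X)%N](Fp_cast p_pr).
move=> c d /eqP; rewrite (eq_prim_root_expr pz0) !modn_small // => /eqP.
exact: val_inj.
Qed.

(** Another representative and another root change [y] only by a root of unity in [F] and an element
    of [E]. Both are fixed by [t], so the ratio of [t y] to [y] depends only on [u] and [t]. *)
Lemma kummer_pairing_exists : exists f : M -> N -> 'F_p,
  forall u t b (Bb : b \in kg_mem B) (y : EB),
    kq_class (elt Bb) = u -> y ^+ p = iota b ->
  sgval (t : add_group (kummer_gal_abelian p_pr muF EB)) y = z0 ^+ (f u t) *: y.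
Proof.
have pz : p.-primitive_root (GRing.in_alg EB z0) by rewrite fmorph_primitive_root.
suff /choice[f fE] : forall ut : M * N, exists c : 'F_p,
    forall b (Bb : b \in kg_mem B) (y : EB),
      kq_class (elt Bb) = ut.1 -> y ^+ p = iota b ->
    sgval (ut.2 : add_group (kummer_gal_abelian p_pr muF EB)) y = z0 ^+ c *: y.
  by exists (fun u t => f (u, t)) => u t; apply: (fE (u, t)).
move=> [u t] /=; set s := sgval _; have sN : s \in kummer_gal EB by apply: subgP.
pose x := kq_repr (u : kummer_quot B).
have [y0 nzy0 y0E] := kummer_root (kg_eltP x).
have [z [z1 sy0]] := kummer_gal_root p_pr muF sN (kg_eltP x) y0E.
have [i iE] := prim_rootP pz0 z1.
exists (inZp i) => b Bb y clb yE.
have [a nza bE] : exists2 a : E, a != 0 & b = val x * a ^+ p.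
  by apply/(kq_classP (elt Bb) x)/eqP; rewrite clb kq_reprK.
have nzx : val x != 0 by apply: kg_neq0 (kg_eltP x).
have [j jE] : {j : 'I_p | y / (y0 * iota a) = GRing.in_alg EB z0 ^+ j}.
  apply: (prim_rootP pz); rewrite expr_div_n exprMn yE y0E bE rmorphM rmorphXn.
  by rewrite divff // mulf_neq0 ?expf_neq0 ?fmorph_eq0.
have yjE : y = z0 ^+ j *: (y0 * iota a).
  rewrite -[LHS](divfK (_ : y0 * iota a != 0)) ?mulf_neq0 ?fmorph_eq0 // jE.
  by rewrite -rmorphXn /= mulr_algl.
rewrite yjE linearZ /= rmorphM /= (kummer_galP _ sN) sy0 -scalerAl !scalerA.
congr (_ *: _); rewrite mulrC iE; congr (_ * _).
by rewrite -(prim_expr_mod pz0 i) /= Fp_cast.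
Qed.

Lemma kummer_gal_isog l :
    cyclic 'Gal({:E} / 1) -> #|'Gal({:E} / 1)%g| = (p ^ l)%N ->
  gmodule_fg M -> gmodule_isog M N.
Proof.
move=> cycG cardG M_fg; have [f fE] := kummer_pairing_exists.
(* A single nonzero root [y] determines the value of the pairing. *)
have fP u t b (Bb : b \in kg_mem B) (y : EB) (c : 'F_p) : y != 0 ->
    kq_class (elt Bb) = u -> y ^+ p = iota b ->
    sgval (t : add_group (kummer_gal_abelian p_pr muF EB)) y = z0 ^+ c *: y ->
  f u t = c.
  move=> nzy clb yE tyE; apply: Fp_expr_inj; apply/eqP; rewrite -subr_eq0.
  rewrite -[_ == 0]orbF -(negbTE nzy) -scaler_eq0 scalerBl.
  by rewrite -(fE u t b Bb y) // tyE subrr.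
have kqP (u : M) : exists b (Bb : b \in kg_mem B), kq_class (elt Bb) = u.
  exists (val (kq_repr (u : kummer_quot B))), (kg_eltP _).
  by rewrite -[RHS](kq_reprK (u : kummer_quot B)); congr kq_class; apply: val_inj.
have fDr u : {morph f u : s t / s + t}.
  move=> s t; have [b [Bb clb]] := kqP u; have [y nzy yE] := kummer_root Bb.
  apply: (fP _ _ _ Bb y) => //; rewrite Fp_exprD.
  transitivity ((sgval s * sgval t)%g y); first by [].
  rewrite galM ?memvf // (fE u s b Bb y) // linearZ /= (fE u t b Bb y) //.
  by rewrite scalerA.
have fDl t : {morph f^~ t : u v / u + v}.
  move=> u v; have [b [Bb clb]] := kqP u; have [y nzy yE] := kummer_root Bb.
  have [c [Bc clc]] := kqP v; have [x nzx xE] := kummer_root Bc.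
  apply: (fP _ _ _ (kg_mul Bb Bc) (y * x)); rewrite ?mulf_neq0 //.
  - rewrite -clb -clc; apply/esym; apply: etrans (kq_addE _ _) _.
    by congr kq_class; apply: val_inj.
  - by rewrite exprMn yE xE rmorphM.
  rewrite rmorphM /= (fE u t b Bb y) // (fE v t c Bc x) //.
  by rewrite -scalerAl -scalerAr scalerA Fp_exprD.
apply: (@gmodule_isog_of_pairing 'F_p p l _ _ M N f) => //.
- by rewrite pchar_Fp.
- by move=> u; apply: fp_additive_scalar.
- by move=> t; apply: (fp_additive_scalar (f := f^~ t)).
(* A root fixed by the whole group comes from [E], so [b] is a [p]-th power there and its class is
   trivial. *)
- move=> u u0; have [b [Bb clb]] := kqP u; have [y nzy yE] := kummer_root Bb.
  have [|a aE] := kummer_gal_fixed_root Bb yE.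
    move=> t tN; have := fE u (Subg tN) b Bb y clb yE.
    by rewrite u0 expr0 scale1r.
  rewrite -clb; apply/eqP/(kq_classP _ (elt1 B)); exists a.
    by apply: contraNneq nzy => a0; rewrite aE a0 rmorph0.
  by apply: (fmorph_inj iota); rewrite /= mul1r -yE aE rmorphXn.
(* An element pairing trivially with every class fixes all the [p]-th roots, and these generate the
   extension. *)
- move=> t t0; apply: val_inj => /=.
  apply: kummer_gal_eq1; first exact: subgP.
  by move=> y b Bb yE; rewrite (fE _ t b Bb y erefl yE) t0 expr0 scale1r.
(* For a lift [h] of [g], [h y] is a root for [g b], and the conjugate of [t] sends it to [h (t y)].
   The scalar is unchanged because [h] fixes [F]. *)
move=> g _ u t; have [b [Bb clb]] := kqP u; have [y nzy yE] := kummer_root Bb.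
have gh : is_lift g (gal_lift EB g) by apply/is_liftP => x; apply: gal_liftP.
apply: (fP _ _ _ (kg_gal (gal_full_in g) Bb) (gal_lift EB g y)).
- by rewrite fmorph_eq0.
- rewrite -clb; apply/esym; apply: etrans (kq_actE _ _) _.
  by congr kq_class; apply: val_inj.
- by rewrite -rmorphXn yE /= gal_liftP.
by apply: etrans (kgal_actP t y gh) _; rewrite (fE u t b Bb y) // linearZ.
Qed.

End KummerPairing.
(** * Existence of the Kummer extension *)

Section SplittingExtension.

Lemma irreducible_factor (F : fieldType) (p : {poly F}) : (1 < size p)%N ->
  exists2 r, irreducible_poly r & r %| p.
Proof.
have [n] := ubnP (size p); elim: n => // n IH in p * => lepn p_gt1.
have [irr_p|red_p] := pselect (irreducible_poly p); first by exists p.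
have [q [q1 qp nqp]] : exists q : {poly F}, [/\ size q != 1%N, q %| p & ~~ (q %= p)].
  apply: contrapT => no_q; apply: red_p; split=> // q q1 qp.
  by apply: contrapT => /negP nqp; apply: no_q; exists q.
have nzp : p != 0 by rewrite -size_poly_gt0 ltnW.
have nzq : q != 0 := dvdpN0 qp nzp.
have ltqp : (size q < size p)%N.
  by rewrite ltn_neqAle dvdp_leq // andbT dvdp_size_eqp.
have [||r irr_r rq] := IH q.
- exact: leq_trans ltqp _.
- by rewrite ltn_neqAle eq_sym q1 size_poly_gt0.
by exists r => //; apply: dvdp_trans qp.
Qed.

(** * Restriction of scalars in a tower of fields *)

Section BaseField.

Variables (F0 : fieldType) (F : fieldExtType F0) (L : fieldExtType F).
Local Notation L0 := (baseFieldType L).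

Definition base_in_alg : F -> L0 := in_alg L.

Fact base_in_alg_linear : linear base_in_alg.
Proof.
move=> a x y; rewrite /base_in_alg rmorphD /=; congr (_ + _).
by rewrite baseField_scaleE scalerA mulr_algl.
Qed.
HB.instance Definition _ := GRing.isLinear.Build F0 F L0 _ base_in_alg base_in_alg_linear.
HB.instance Definition _ := GRing.isMonoidMorphism.Build F L0 base_in_alg
  (rmorphism_monoidP (in_alg L)).

Definition base_ahom : 'AHom(F, L0) := linfun_ahom base_in_alg.

Lemma base_ahomE x : base_ahom x = x%:A :> L.
Proof. by rewrite lfunE. Qed.

(** A subfield over [F0] that contains the image of [F] is also a subfield over [F], where
    generation by [zs] applies. *)
Lemma base_adjoin_full (K : {subfield L0}) (zs : seq L) :
    <<1 & zs>>%VS = {:L}%VS -> (limg base_ahom <= K)%VS ->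
    {subset zs <= K} -> K = {:L0}%VS :> {vspace L0}.
Proof.
move=> full_zs sFK zsK.
have sRK : (refBaseField L <= K)%VS.
  apply/subvP => x; rewrite refBaseField.unlock mem_baseVspace => /vlineP[c ->].
  by rewrite -base_ahomE (subvP sFK) ?memv_img ?memvf.
have [K' defK memK] := module_baseAspace sRK.
have fullK' : ({:L} <= K')%VS.
  rewrite -full_zs; apply/Fadjoin_seqP; split; first exact: sub1v.
  by move=> z /zsK; rewrite -memK.
apply/vspaceP => x; rewrite memvf memK.
by rewrite (subvP fullK' (x : L)) // memvf.
Qed.

End BaseField.

(** Adjoin a root of an irreducible factor, split the cofactor over the larger field, then restrict
    scalars. The induction on the size of [p] must therefore let the base field vary. *)
Lemma exists_splitting_ext (F : fieldType) (p : {poly F}) : p != 0 ->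
  exists (L : fieldExtType F) (zs : seq L),
    map_poly (in_alg L) p %= \prod_(z <- zs) ('X - z%:P)
    /\ <<1 & zs>>%VS = {:L}%VS.
Proof.
have [n] := ubnP (size p); elim: n => // n IH in F p * => lepn nzp.
have [p_le1|p_gt1] := leqP (size p) 1.
  exists F^o, [::]; split.
    rewrite big_nil -size_poly_eq1 size_map_poly eqn_leq p_le1.
    by rewrite size_poly_gt0.
  by rewrite Fadjoin_nil regular_fullv.
have [r irr_r r_dv_p] := irreducible_factor p_gt1.
have [K _ [x rx0 full_x]] := irredp_FAdjoin irr_r.
have /factor_theorem[q pE] : root (map_poly (in_alg K) p) x.
  by rewrite -(divpK r_dv_p) rmorphM rootM rx0 orbT.
have nzq : q != 0.
  apply: contraNneq nzp => q0; move/eqP: pE.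
  by rewrite q0 mul0r map_poly_eq0.
have [|L [zs [qE full_zs]]] := IH K q _ nzq.
  rewrite -ltnS; apply: leq_trans lepn; rewrite ltnS -(size_map_poly (in_alg K) p).
  by rewrite pE size_Mmonic ?monicXsubC // size_XsubC addn2.
exists (baseFieldType L), (base_ahom L x :: zs); split.
  rewrite big_cons mulrC.
  have -> : map_poly (in_alg (baseFieldType L)) p
      = map_poly (in_alg L) (map_poly (in_alg K) p).
    rewrite -map_poly_comp; apply: eq_map_poly => c.
    by rewrite /= baseField_scaleE.
  rewrite pE rmorphM rmorphB /= map_polyX map_polyC /= base_ahomE.
  exact: eqp_mulr qE.
have full := @base_adjoin_full _ _ L <<1 & base_ahom L x :: zs>>%AS zs full_zs.
apply: full; last first.
  by move=> z zs_z; apply: seqv_sub_adjoin; rewrite inE zs_z orbT.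
rewrite -full_x aimg_adjoin aimg1 -adjoin_seq1; apply: adjoin_seqSr => z.
by rewrite !inE => /eqP->; rewrite eqxx.
Qed.

End SplittingExtension.

(** * Normality over the base field and construction of the Kummer extension *)

Lemma polyOver1_map (F : fieldType) (aT rT : fieldExtType F) (f : 'AHom(aT, rT))
    (r : {poly aT}) : r \is a polyOver 1%VS -> map_poly f r \is a polyOver 1%VS.
Proof.
move=> /polyOverP Fr; apply/polyOverP => i; rewrite coef_map /=.
by have /vlineP[c ->] := Fr i; rewrite linearZ /= rmorph1 memvZ ?mem1v.
Qed.

Section KummerExtExists.

Variables (F : fieldType) (E : splittingFieldType F).

(** An element of the Galois group permutes the factors, so the coefficients of the product lie in
    its fixed field, which is [F]. *)
Lemma gal_norm_polyOver (q : {poly E}) : galois 1 {:E} ->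
  \prod_(g in 'Gal({:E} / 1)%g) map_poly (g : gal_of {:E}) q \is a polyOver 1%VS.
Proof.
move=> /galois_fixedField galE; set Q := \prod_(g in _) _; apply/polyOverP => i.
rewrite -galE; apply/fixedFieldP; rewrite ?memvf // => h Gh.
rewrite -coef_map; suff -> : map_poly h Q = Q by [].
rewrite rmorph_prod /Q [RHS](reindex_inj (mulIg h)) /=.
apply: eq_big => [g|g Gg]; first by rewrite groupMr.
rewrite -map_poly_comp; apply: eq_map_poly => x /=.
by rewrite galM ?memvf.
Qed.

(** If [E] is the splitting field of [r] over [F], then [L] is that of [r * q], whose coefficients
    are in [F]. *)
Lemma base_splitting (L : fieldExtType E) (q : {poly E}) (zs : seq L) :
    q \is a polyOver 1%VS ->
    map_poly (in_alg L) q %= \prod_(z <- zs) ('X - z%:P) ->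
    <<1 & zs>>%VS = {:L}%VS ->
  SplittingField.axiom (baseFieldType L).
Proof.
move=> Fq qE full_zs; have [r Fr [rs rE full_rs]] := splittingFieldP E.
pose iota := base_ahom L.
exists (map_poly iota (r * q)).
  by apply: polyOver1_map; rewrite rpredM.
exists (map iota rs ++ zs).
  rewrite rmorphM big_cat /=.
  apply: (@eqp_trans _
    (map_poly iota (\prod_(z <- rs) ('X - z%:P)) * map_poly iota q)).
    by rewrite eqp_mulr // eqp_map.
  rewrite rmorph_prod big_map.
  under eq_bigr do rewrite rmorphB /= map_polyX map_polyC.
  apply: eqp_mull; rewrite (_ : map_poly iota q = map_poly (in_alg L) q) //.
  by apply: eq_map_poly => x; rewrite base_ahomE.
have full := @base_adjoin_full _ _ L <<1 & map iota rs ++ zs>>%AS zs full_zs.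
apply: full; last first.
  by move=> z zs_z; apply: seqv_sub_adjoin; rewrite mem_cat zs_z orbT.
rewrite -full_rs aimg_adjoin_seq aimg1; apply: adjoin_seqSr => z.
by rewrite mem_cat => ->.
Qed.

Lemma exists_splitting_over (q : {poly E}) : q != 0 -> q \is a polyOver 1%VS ->
  exists (L : splittingFieldType F) (iota : 'AHom(E, L)) (zs : seq L),
    map_poly iota q %= \prod_(z <- zs) ('X - z%:P) /\
    forall K : {subfield L}, (limg iota <= K)%VS -> {subset zs <= K} ->
      K = {:L}%VS :> {vspace L}.
Proof.
move=> nzq Fq; have [L [zs [zsE full_zs]]] := exists_splitting_ext nzq.
pose L1 : splittingFieldType F := HB.pack (baseFieldType L)
  (FieldExt_isSplittingField.Build F (baseFieldType L)
     (base_splitting Fq zsE full_zs)).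
exists L1, (base_ahom L), zs; split; last by move=> K; apply: base_adjoin_full.
rewrite (_ : map_poly _ q = map_poly (in_alg L) q) //.
by apply: eq_map_poly => x; apply: base_ahomE.
Qed.

Variables (p : nat) (p_pr : prime p) (B : kummer_group p E).
Local Notation M := (kummer_module B p_pr).

Lemma kummer_ext_exists : galois 1 {:E} -> (exists z : F, p.-primitive_root z) ->
  gmodule_fg M -> inhabited (kummer_ext B).
Proof.
move=> galE [z0 pz0] [s span_s].
have p_gt0 := prime_gt0 p_pr.
pose bs := [seq val (kq_repr (u : kummer_quot B)) | u <- s].
pose q0 : {poly E} := \prod_(b <- bs) ('X^p - b%:P).
pose q := \prod_(g in 'Gal({:E} / 1)%g) map_poly (g : gal_of {:E}) q0.
have qE : q = \prod_(g in 'Gal({:E} / 1)%g)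
    \prod_(b <- bs) ('X^p - ((g : gal_of {:E}) b)%:P).
  apply: eq_bigr => g _; rewrite rmorph_prod; apply: eq_bigr => b _.
  by rewrite rmorphB /= map_polyXn map_polyC.
have nzq : q != 0.
  rewrite qE; apply/monic_neq0/monic_prod => g _; apply: monic_prod => b _.
  exact: monicXnsubC.
have [L [iota [zs [zsE full_zs]]]] :=
  exists_splitting_over nzq (gal_norm_polyOver q0 galE).
have iota_root (f : {poly E}) :
    f %| q -> (1 < size f)%N -> exists y, root (map_poly iota f) y.
  move=> f_q szf.
  have : map_poly iota f %| \prod_(z <- zs) ('X - z%:P).
    by rewrite -(eqp_dvdr _ zsE) dvdp_map.
  case/dvdp_prod_XsubC => m mE.
  have : (1 < size (\prod_(z <- mask m zs) ('X - z%:P))%R)%N.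
    by rewrite -(eqp_size mE) size_map_poly.
  rewrite size_prod_XsubC ltnS; case: (mask m zs) mE => // y ys mE _.
  by exists y; rewrite (eqp_root mE) root_prod_XsubC mem_head.
(* Some representative of the class has a [p]-th root in [L]. This holds for the translates of the
   generators, whose ['X^p - (a b)%:P] divides [q], and is stable under linear combinations. *)
pose P (u : M) := exists b (Bb : b \in kg_mem B) (y : L),
  kq_class (elt Bb) = u /\ y ^+ p = iota b.
have P0 : P 0.
  exists 1, (kg_1 B), 1; split; last by rewrite expr1n rmorph1.
  by congr kq_class; apply: val_inj.
have PD u v : P u -> P v -> P (u + v).
  move=> [b [Bb [y [<- yE]]]] [c [Bc [x [<- xE]]]].
  exists (b * c), (kg_mul Bb Bc), (y * x); split.
    apply/esym; apply: etrans (kq_addE _ _) _.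
    by congr kq_class; apply: val_inj.
  by rewrite exprMn yE xE rmorphM.
have PZ (c : 'F_p) u : P u -> P (c *: u).
  move=> Pu; suff Pn n : P ((u : kummer_quot B) *+ n) by exact: Pn.
  by elim: n => [|n IH]; rewrite ?mulr0n // mulrS; apply: PD.
have Ps (i : 'I_(size s)) a : P (gmod_act M s`_i a).
  pose b := val (kq_repr (s`_i : kummer_quot B)).
  have bs_b : b \in bs by apply/mapP; exists s`_i; rewrite ?mem_nth.
  have [] := iota_root ('X^p - (a b)%:P).
  - rewrite qE (bigD1 a) ?gal_full_in //=; apply: dvdp_mulr.
    by rewrite (big_rem b) //=; apply: dvdp_mulr.
  - by rewrite size_XnsubC // ltnS.
  move=> y; rewrite rmorphB /= map_polyXn map_polyC rootE !hornerE subr_eq0 => /eqP yE.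
  exists (a b), (kg_gal (gal_full_in a) (kg_eltP _)), y; split; last exact: yE.
  by congr kq_class; apply: val_inj.
have Pall u : P u.
  have [c ->] := span_s u; apply: (big_ind P) => // i _.
  by apply: (big_ind P) => // a _; apply: PZ.
(* Two representatives differ by a [p]-th power from [E], so one root in [L] yields the other. *)
have root_B b : b \in kg_mem B -> exists y : L, y ^+ p = iota b.
  move=> Bb; have [c [Bc [y [clc yE]]]] := Pall (kq_class (elt Bb)).
  have /eqP/(kq_classP (elt Bb) (elt Bc))[a nza /= ->] := esym clc.
  by exists (y * iota a); rewrite exprMn yE rmorphM rmorphXn.
have pz : p.-primitive_root (GRing.in_alg L z0) by rewrite fmorph_primitive_root.
split; refine (@KummerExt p F E B L iota _ _).
- move=> b Bb; have [y yE] := root_B b Bb.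
  have nzy : y != 0.
    apply: contraTneq (kg_neq0 Bb) => y0.
    by rewrite negbK -(fmorph_eq0 iota) -[X in X == _]yE y0 expr0n eqn0Ngt p_gt0.
  have [rs _ rsE] := Xn_sub_exp_prod p_gt0 pz nzy.
  by exists rs; rewrite -yE.
(* Each root of [q] is a [p]-th root of some [g b], which is again in [B]. *)
move=> K sEK rootsK; apply: full_zs => // z zs_z.
have : root (map_poly iota q) z.
  by rewrite (eqp_root zsE) root_prod_XsubC.
rewrite qE rmorph_prod rootE horner_prod => /prodf_eq0[g _].
rewrite rmorph_prod horner_prod prodf_seq_eq0 => /hasP[_ /mapP[u _ ->]] /=.
rewrite rmorphB /= map_polyXn map_polyC !hornerE subr_eq0 => /eqP zE.
exact: (rootsK z _ (kg_gal (gal_full_in g) (kg_eltP _)) zE).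
Qed.

End KummerExtExists.
Theorem theorem2p6 (p l : nat) (p_pr : prime p) (l_gt0 : (0 < l)%N)
    (F : fieldType) (E : splittingFieldType F)
    (galE : galois 1 {:E}) (cycE : cyclic 'Gal({:E} / 1))
    (degE : \dim {:E} = (p ^ l)%N)
    (muF : exists z : F, p.-primitive_root z)
    (B : kummer_group p E)
    (B_fg : gmodule_fg (kummer_module B p_pr)) :
  inhabited (kummer_ext B) /\
  forall EB : kummer_ext B,
    gmodule_isog (kummer_module B p_pr) (kummer_gal_module p_pr muF EB).
Proof.
split; first exact: kummer_ext_exists B_fg.
have cardG : #|'Gal({:E} / 1)%g| = (p ^ l)%N.
  by rewrite -(galois_dim galE) dimv1 divn1.
by move=> EB; have [z0 pz0] := muF; apply: kummer_gal_isog pz0 _ cycE cardG B_fg.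
Qed.
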